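(* For all $n\ge1$, $$\sum_{\sigma\in\mathfrak S_n}q^{\mathrm{rmaj}_2(\sigma)}t^{\mathrm{des}(\sigma^{-1})}=\sum_{\sigma\in\mathfrak S_n}q^{\mathrm{maj}(\sigma)}t^{\mathrm{exc}(\sigma)}.$$
   Context: For $\sigma\in\mathfrak S_n$ in one-line notation: $\mathrm{exc}(\sigma)=|\{i\in[n-1]:\sigma(i)>i\}|$; $\mathrm{Des}(\sigma)=\{i\in[n-1]:\sigma(i)>\sigma(i+1)\}$, $\mathrm{des}(\sigma)=|\mathrm{Des}(\sigma)|$, $\mathrm{maj}(\sigma)=\sum_{i\in\mathrm{Des}(\sigma)}i$. The Rawlings major index with $k=2$ is $\mathrm{rmaj}_2(\sigma)=\mathrm{inv}_{<2}(\sigma)+\mathrm{maj}_{\ge2}(\sigma)$, where $\mathrm{inv}_{<2}(\sigma)=|\{(i,j)\in[n]\times[n]:i<j,\ \sigma(i)-\sigma(j)=1\}|$ and $\mathrm{maj}_{\ge2}(\sigma)=\sum\{i\in[n-1]:\sigma(i)-\sigma(i+1)\ge2\}$. *)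

(* Defs.v *)
From mathcomp Require Import all_boot all_algebra all_fingroup.

Set Implicit Arguments.
Unset Strict Implicit.
Unset Printing Implicit Defensive.

(* A permutation of [n] is s : 'S_n acting on 'I_n = {0, .., n-1}: position
   and value k of [n] are represented by the ordinal k-1. Hence differences of
   values are unchanged, while a position contributes i.+1 to maj and to
   maj_ge2. *)

Definition exc (n : nat) (s : 'S_n) : nat :=
  #|[set i : 'I_n | (i.+1 < n) && (i < s i)]|.

Definition Des (n : nat) (s : 'S_n) : {set 'I_n} :=
  [set i : 'I_n | [exists j : 'I_n, (j == i.+1 :> nat) && (s j < s i)]].

Definition des (n : nat) (s : 'S_n) : nat := #|Des s|.

Definition maj (n : nat) (s : 'S_n) : nat := \sum_(i in Des s) i.+1.

Definition inv_lt2 (n : nat) (s : 'S_n) : nat :=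
  #|[set p : 'I_n * 'I_n | (p.1 < p.2) && (s p.1 == (s p.2).+1 :> nat)]|.

Definition maj_ge2 (n : nat) (s : 'S_n) : nat :=
  \sum_(i < n | [exists j : 'I_n, (j == i.+1 :> nat) && (s j + 2 <= s i)]) i.+1.

Definition rmaj2 (n : nat) (s : 'S_n) : nat := inv_lt2 s + maj_ge2 s.

(* Z[q,t] is realised as Z[q][t]. *)
Definition q_var : {poly {poly int}} := ('X%:P)%R.
Definition t_var : {poly {poly int}} := 'X%R.

(* Main.v *)
Require Import Defs.
From mathcomp Require Import all_boot all_algebra all_fingroup zify ring.

(* Put x = q t.  Since inv_lt2 s = des s^-1 and maj s = exc s + sum (DEX s),
   where DEX s is the descent set of the word of s with its excedance letters
   barred, it suffices that for every set S of positions the sum of x ^ exc s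
   over DEX s \subset S equals the sum of x ^ des s^-1 over Des2 s \subset S,
   Des2 being the set of descents of size at least 2; weighting by q and
   inverting over S then gives the theorem.

   Cut the positions into blocks at S and read s^-1 as the word w of the blocks
   of its letters.  On the Des2 side, w contributes the product over consecutive
   letters a, b of 1, x or 1 + x according to a < b, a > b or a = b.  On the DEX
   side, w contributes the product over j of the same weight of the pair
   (block of j, w_j), except that the smallest j of a block gets weight 1 when
   w_j is that block.  Reading the pairs of the second product as a stack of
   exits attached to each letter and following the exits from the largest
   letter N until its stack is empty cuts off a closed walk, which is the part
   of a word starting at the first N; this matches the two sums by induction. *)

Set Implicit Arguments.
Unset Strict Implicit.
Unset Printing Implicit Defensive.

Import GRing.Theory.

Local Open Scope ring_scope.

(** * Sums over the rearrangements of a word *)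

Lemma reindex_permutations (R : nmodType) (T : eqType) (s : seq T)
    (f : seq T -> seq T) (F : seq T -> R) :
    (forall w, perm_eq w s -> perm_eq (f w) s) ->
    {in [pred w | perm_eq w s] &, injective f} ->
  \sum_(w <- permutations s) F w = \sum_(w <- permutations s) F (f w).
Proof.
move=> fs finj; rewrite -(big_map f predT F) /=.
apply: perm_big; rewrite perm_sym.
have mem_p w : w \in permutations s -> perm_eq w s by rewrite mem_permutations.
have u : uniq (map f (permutations s)).
  rewrite map_inj_in_uniq ?permutations_uniq // => a b /mem_p sa /mem_p sb.
  exact: finj.
have sub : {subset map f (permutations s) <= permutations s}.
  by move=> _ /mapP[w /mem_p sw ->]; rewrite mem_permutations; apply: fs.
apply: uniq_perm => //; first exact: permutations_uniq.
by have [] := uniq_min_size u sub; rewrite ?size_map.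
Qed.

Lemma permutations_sum_cons (R : nmodType) (T : eqType) (s : seq T)
    (F : seq T -> R) : (0 < size s)%N ->
  \sum_(w <- permutations s) F w =
  \sum_(a <- undup s) \sum_(w <- permutations (rem a s)) F (a :: w).
Proof.
by move=> s0; rewrite (perm_big _ (permutationsE s0)) big_allpairs_dep.
Qed.

(** * Walks, exits and the identity of the two word sums *)

Section WordSums.

Variables (R : comNzRingType) (x : R).
Implicit Types (a v N : nat) (w c s : seq nat) (e : seq (nat * bool)).

(** The exponent of [x] is a descent flag: unequal letters force it, equal letters leave both
    values, hence [1 + x]. *)
Definition step_weight a b : R :=
  if (a < b)%N then 1 else if (b < a)%N then x else 1 + x.

Fixpoint walk_weight v w : R :=
  if w is a :: w' then step_weight v a * walk_weight a w' else 1.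

Definition word_weight w : R := if w is a :: w' then walk_weight a w' else 1.

Lemma word_weightE w : word_weight w =
  \prod_(j < size w)
    if (j.+1 < size w)%N then step_weight (nth 0%N w j) (nth 0%N w j.+1) else 1.
Proof.
case: w => [|a w] /=; first by rewrite big_ord0.
elim: w a => [|b w IHw] a /=; first by rewrite big_ord_recl big_ord0 mulr1.
by rewrite big_ord_recl /= IHw.
Qed.

(* An exit (v, last) from the letter v is marked when it is the last one: it
   then carries weight 1 instead of 1 + x if it leads back to v. *)
Definition exit_weight (e : nat * bool) a : R :=
  if e.2 && (e.1 == a) then 1 else step_weight e.1 a.

(** One exit from each letter is marked, at its last occurrence; only the multiset of exits matters,
    by [perm_exit_suml]. *)
Fixpoint exits c : seq (nat * bool) :=
  if c is a :: c' then (a, a \notin c') :: exits c' else [::].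

Definition exit_sum e s : R :=
  \sum_(w <- permutations s) \prod_(p <- zip e w) exit_weight p.1 p.2.

Lemma size_exits c : size (exits c) = size c.
Proof. by elim: c => //= a c ->. Qed.

Lemma count_exits c a (l : bool) : count_mem (a, l) (exits c) =
  if l then a \in c : nat else (count_mem a c - (a \in c))%N.
Proof.
have cnt d : (a \in d) = (0 < count_mem a d)%N by rewrite -has_count has_pred1.
elim: c => [|b c IHc] /=; first by case: l.
rewrite {}IHc xpair_eqE inE !cnt (eq_sym a b).
case: (eqVneq b a) => [->|_] /=; rewrite ?cnt; case: l => /=; lia.
Qed.

Lemma perm_exits c d : perm_eq c d -> perm_eq (exits c) (exits d).
Proof.
move=> cd; apply/allP => -[a l] _ /=; apply/eqP.
by rewrite !count_exits (perm_mem cd) (seq.permP cd).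
Qed.

Lemma exit_sum_cons p e s : (0 < size s)%N ->
  exit_sum (p :: e) s =
  \sum_(a <- undup s) exit_weight p a * exit_sum e (rem a s).
Proof.
move=> s0; rewrite /exit_sum permutations_sum_cons //.
apply: eq_bigr => a _; rewrite mulr_sumr; apply: eq_bigr => w _.
by rewrite /= big_cons.
Qed.

(** Reordering the exits is compensated by reordering each word [w] in the same way, which permutes
    the rearrangements of [s]. *)
Lemma perm_exit_suml e e' s : size e = size s -> perm_eq e e' ->
  exit_sum e s = exit_sum e' s.
Proof.
move=> se; rewrite perm_sym => /(perm_iotaP (0%N, false))[Is pIs ->].
pose f w := [seq nth 0%N w i | i <- Is].
rewrite [RHS](@reindex_permutations _ _ _ f).
- apply: eq_big_seq => w; rewrite mem_permutations => /perm_size sw.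
  have -> : zip [seq nth (0%N, false) e i | i <- Is] (f w)
          = [seq (nth (0%N, false) e i, nth 0%N w i) | i <- Is].
    by rewrite /f; elim: (Is) => //= i Is' ->.
  rewrite big_map (perm_big _ pIs) (big_nth ((0%N, false), 0%N)).
  rewrite size1_zip ?se ?sw // /index_iota subn0.
  by apply: eq_big_seq => i; rewrite mem_iota => /= ilt; rewrite nth_zip ?se ?sw.
- move=> w sw; apply: perm_trans (sw); apply/(perm_iotaP 0%N).
  by exists Is; rewrite // (perm_size sw) -se.
move=> w w'; rewrite !inE => sw sw' /eq_in_map eqn.
apply: (@eq_from_nth _ 0%N); first by rewrite (perm_size sw) (perm_size sw').
move=> i ilt; apply: eqn.
by rewrite (perm_mem pIs) mem_iota /= se -(perm_size sw).
Qed.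

Lemma perm_exit_sumr e s s' : perm_eq s s' -> exit_sum e s = exit_sum e s'.
Proof. by move=> ss'; apply: perm_big; apply: perm_permutations. Qed.

(* The word p ++ N :: u with N \notin u is weighted as the walk v :: p and the
   separate word u. *)
Fixpoint split_weight N v w : R :=
  if w is a :: w' then
    if N \in w' then step_weight v a * split_weight N a w'
    else if a == N then word_weight w' else 0
  else 0.

Lemma split_weightE N v p u : N \notin u ->
  split_weight N v (p ++ N :: u) = walk_weight v p * word_weight u.
Proof.
move=> Nu; elim: p v => [|a p IHp] v /=; first by rewrite (negPf Nu) eqxx mul1r.
by rewrite mem_cat mem_head orbT IHp mulrA.
Qed.

(** The displayed [N] is entered from a smaller letter, and such a step weighs 1. *)
Lemma walk_weight_cat v u N p : (v < N)%N -> all (ltn^~ N) u ->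
  walk_weight v (u ++ N :: p) = walk_weight v u * walk_weight N p.
Proof.
elim: u v => [|a u IHu] v vN /=; first by rewrite /step_weight vN.
by case/andP=> aN uN; rewrite IHu // mulrA.
Qed.

(** Rotation: if [w] is [u], [N], [p] with [N] absent from [u], then the [split_weight] of [p], [N],
    [u] is [word_weight w], since the step from [u] up to [N] weighs 1. *)
Lemma sum_word_weight_split N c : all (leq^~ N) c ->
  \sum_(w <- permutations (N :: c)) word_weight w =
  \sum_(w <- permutations (N :: c)) split_weight N N w.
Proof.
move=> leN.
pose f w := drop (index N w).+1 w ++ N :: take (index N w) w.
have Nin w : perm_eq w (N :: c) -> N \in w.
  by move/perm_mem->; rewrite mem_head.
have wE w : N \in w -> w = take (index N w) w ++ N :: drop (index N w).+1 w.
  by move=> Nw; rewrite -{1}(cat_take_drop (index N w) w) (drop_nth 0%N)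
       ?index_mem // nth_index.
have Nt w : N \notin take (index N w) w.
  elim: w => //= a w IHw; case: (eqVneq a N) => //= aN.
  by rewrite inE negb_or eq_sym aN.
rewrite [RHS](@reindex_permutations _ _ _ f).
- apply: eq_big_seq => w; rewrite mem_permutations => pw.
  rewrite split_weightE // {1}(wE w (Nin _ pw)).
  have : all (ltn^~ N) (take (index N w) w).
    apply/allP=> a ain; rewrite /= ltn_neqAle.
    rewrite (memPn (Nt w) a ain) /=.
    have := mem_take ain; rewrite (perm_mem pw) inE => /orP[/eqP->//|].
    by move/(allP leN).
  case: (take _ w) => [|a u] /=; first by rewrite mulr1.
  by case/andP=> aN uN; rewrite walk_weight_cat // mulrC.
- move=> w pw; apply: perm_trans (pw).
  rewrite [X in perm_eq _ X](wE w (Nin _ pw)) /f perm_catC perm_sym.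
  by rewrite -[N :: drop _ _]cat1s perm_catCA.
(* Reversal turns the [N] placed by [f] into the first one, whose index recovers the length of the
   prefix. *)
move=> w w'; rewrite !inE => /Nin Nw /Nin Nw' /(congr1 rev).
rewrite /f !rev_cat !rev_cons !cat_rcons => eqf.
have idx u r : N \notin u -> index N (rev u ++ N :: r) = size u.
  by move=> Nu; rewrite index_cat mem_rev (negPf Nu) /= eqxx addn0 size_rev.
have sz : size (take (index N w) w) = size (take (index N w') w').
  by rewrite -(idx _ (rev (drop (index N w).+1 w)) (Nt w)) eqf idx.
have /eqP := eqf; rewrite eqseq_cat ?size_rev // eqseq_cons eqxx /=.
rewrite !(inj_eq (can_inj revK)) => /andP[/eqP t /eqP d].
by rewrite (wE w Nw) (wE w' Nw') t d.
Qed.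

(* Following the unused exits from v, one always returns to N once all the
   letters N have been left; the walk is then closed, and the remaining exits
   form a smaller instance of the same problem. *)
Lemma exit_sum_walk N v c :
    (forall c', (size c' <= size c)%N -> exit_sum (exits c') c' =
       \sum_(w <- permutations c') word_weight w) ->
    all (leq^~ N) (v :: c) ->
  exit_sum (exits (v :: c)) (N :: c) =
  \sum_(w <- permutations (N :: c)) split_weight N v w.
Proof.
elim: {c}(size c) {-2}c (leqnn (size c)) v => [|n IHn] c sc v IHA leN.
  case: c sc IHA leN => // _ _ /=; rewrite andbT => vN.
  rewrite /exit_sum /= /permutations /= !big_cons !big_nil /= !addr0 eqxx mulr1.
  rewrite /exit_weight /step_weight /=; case: (ltngtP v N) vN => //.
rewrite /= exit_sum_cons // permutations_sum_cons //.
rewrite [LHS]big_seq [RHS]big_seq.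
apply: eq_bigr => a; rewrite mem_undup => aNc /=.
(* If [a] is absent from [c], it is the last remaining [N]: the walk closes, and [c] with its own
   exits is the smaller instance. *)
have [ac|aNotc] := boolP (a \in c); last first.
  move: aNc; rewrite inE (negPf aNotc) orbF => /eqP eaN; subst a.
  rewrite eqxx IHA // mulr_sumr; apply: eq_big_seq => w.
  rewrite mem_permutations => /perm_mem->; rewrite (negPf aNotc).
  rewrite /exit_weight /step_weight /=.
  case/andP: leN => vN _; case: (ltngtP v N) vN => [||vN] // _.
  - by rewrite andbF mul1r.
  by rewrite vN aNotc mul1r.
have pr : perm_eq (rem a (N :: c)) (N :: rem a c).
  by rewrite /=; case: (eqVneq N a) => // ->; apply: perm_to_rem.
have sr : size (rem a c) = (size c).-1 by rewrite size_rem.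
have c0 : (0 < size c)%N by case: (c) ac.
rewrite (perm_exit_sumr _ pr) (perm_big _ (perm_permutations pr)) /=.
have -> : exit_sum (exits c) (N :: rem a c) =
          exit_sum (exits (a :: rem a c)) (N :: rem a c).
  apply: perm_exit_suml; first by rewrite size_exits /= sr prednK.
  by apply: perm_exits; rewrite perm_to_rem.
rewrite IHn; first last.
- apply/allP => b; rewrite -(perm_mem (perm_to_rem ac)) => bc.
  by apply: (allP leN); rewrite inE bc orbT.
- by move=> c'; rewrite sr => sc'; apply: IHA; lia.
- by rewrite sr; lia.
rewrite mulr_sumr; apply: eq_big_seq => w.
rewrite mem_permutations => /perm_mem->; rewrite mem_head.
(* A marked exit back to [v = a] would require [v \notin c], against [a \in c]. *)
congr (_ * _); rewrite /exit_weight /=.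
by case: (eqVneq v a) => [->|]; rewrite ?ac ?andbF.
Qed.

(** With [N] the largest letter, the walk from [N] yields a sum of [split_weight], and the rotation
    returns to [word_weight]. *)
Theorem exit_sum_exits c :
  exit_sum (exits c) c = \sum_(w <- permutations c) word_weight w.
Proof.
elim: {c}(size c) {-2}c (leqnn (size c)) => [|n IHn] c sc.
  by case: c sc => // _; rewrite /exit_sum /permutations /= !big_cons !big_nil.
have [->|c0] := eqVneq c [::].
  by rewrite /exit_sum /permutations /= !big_cons !big_nil.
pose N := \max_(a <- c) a.
have leN a : a \in c -> (a <= N)%N by move=> ac; apply: leq_bigmax_seq.
have Nc : N \in c.
  have : has predT c by rewrite has_predT; case: (c) c0.
  rewrite /N; case: (c) => // a c' _.
  elim: c' a => [|b c' IH] a; first by rewrite big_seq1 mem_head.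
  rewrite big_cons; set M := \max_(i <- _) i.
  have := IH b; rewrite -/M => Mb.
  by rewrite /maxn; case: ifP; rewrite ?mem_head // inE Mb orbT.
have pc := perm_to_rem Nc.
have -> : exit_sum (exits c) c = exit_sum (exits (N :: rem N c)) (N :: rem N c).
  rewrite (perm_exit_sumr _ pc); apply: perm_exit_suml.
    by rewrite size_exits (perm_size pc).
  exact: perm_exits.
have leNr : all (leq^~ N) (N :: rem N c).
  by apply/allP => a; rewrite -(perm_mem pc); apply: leN.
have c1 : (0 < size c)%N by case: (c) c0.
rewrite exit_sum_walk //.
  rewrite -sum_word_weight_split; last by case/andP: leNr.
  by apply: perm_big; rewrite perm_sym; apply: perm_permutations.
by move=> c'; rewrite size_rem // => sc'; apply: IHn; rewrite (leq_trans sc') // -ltnS prednK.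
Qed.

End WordSums.

(** * Standardization: permutations from injective keys *)

Section Ranks.

Variable n : nat.
Implicit Types (s : 'S_n) (i j k : 'I_n).

Lemma card_ord_ltn m : (m <= n)%N -> #|[set i : 'I_n | (i < m)%N]| = m.
Proof.
move=> mn; have -> : [set i : 'I_n | (i < m)%N] = widen_ord mn @: [set: 'I_m].
  apply/setP => i; rewrite inE; apply/idP/imsetP => [im|[j _ ->]]; last first.
    exact: ltn_ord j.
  by exists (Ordinal im) => //; apply: val_inj.
rewrite card_imset ?cardsT ?card_ord // => i j /(congr1 val) /= ij.
exact: val_inj.
Qed.

Lemma card_perm_lt s i : #|[set j | (s j < s i)%N]| = s i.
Proof.
rewrite -[RHS](card_ord_ltn (ltnW (ltn_ord (s i)))).
rewrite -[RHS](card_preimset _ (@perm_inj _ s)).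
by apply: eq_card => j; rewrite !inE.
Qed.

(** Each value of a permutation is the number of smaller values, so the relative order determines
    the permutation. *)
Lemma perm_order_inj s s' :
  (forall i j, (s i < s j)%N -> (s' i < s' j)%N) -> s = s'.
Proof.
move=> ss'; apply/permP => i; apply/val_inj => /=.
rewrite -(card_perm_lt s) -(card_perm_lt s'); apply: eq_card => j; rewrite !inE.
apply/idP/idP => [/ss'//|]; case: (ltngtP (s j) (s i)) => // [/ss'|].
  by move=> s'ij /(ltn_trans s'ij); rewrite ltnn.
by move/val_inj/perm_inj->; rewrite ltnn.
Qed.

Lemma rank_perm (key : 'I_n -> nat) : injective key ->
  {s : 'S_n | forall i j, (s i < s j)%N = (key i < key j)%N}.
Proof.
move=> key_inj.
have rank_lt i : (#|[set j | (key j < key i)%N]| < n)%N.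
  rewrite -[X in (_ < X)%N]card_ord -cardsT; apply: proper_card.
  by apply/properP; split; [exact: subsetT | exists i; rewrite ?inE ?ltnn].
pose r i := Ordinal (rank_lt i).
have rE i j : (r i < r j)%N = (key i < key j)%N.
  have mono i1 j1 : (key i1 <= key j1)%N -> (r i1 <= r j1)%N.
    move=> le; apply: subset_leq_card; apply/subsetP => k; rewrite !inE.
    by move=> kl; apply: leq_trans le.
  apply/idP/idP => [|lt].
    by rewrite ltnNge; apply: contraR; rewrite -leqNgt => /mono.
  apply: proper_card; apply/properP; split.
    by apply/subsetP => k; rewrite !inE => /ltn_trans; apply.
  by exists i; rewrite inE ?ltnn.
have r_inj : injective r.
  move=> i j rij; apply: key_inj.
  by have := rE i j; have := rE j i; rewrite rij ltnn; case: ltngtP.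
by exists (perm r_inj) => i j; rewrite !permE rE.
Qed.

(** Standardization by [key e] inverts [E]: each [s] in [P] is ordered by [key (E s)], and
    standardizing an admissible [e] gives back [e]. *)
Lemma sum_perm_rank (R : nmodType) (key : {ffun 'I_n -> bool} -> 'I_n -> nat)
    (E : 'S_n -> {ffun 'I_n -> bool}) (P : pred 'S_n)
    (Q : pred {ffun 'I_n -> bool}) (F : {ffun 'I_n -> bool} -> R) :
    (forall e, injective (key e)) ->
    (forall s, P s -> Q (E s)) ->
    (forall s, P s -> forall i j, (key (E s) i < key (E s) j)%N -> (s i < s j)%N) ->
    (forall e s, Q e -> (forall i j, (s i < s j)%N = (key e i < key e j)%N) ->
       P s /\ E s = e) ->
  \sum_(s | P s) F (E s) = \sum_(e | Q e) F e.
Proof.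
move=> key_inj PQ Pkey Qkey; pose h e := sval (rank_perm (key_inj e)).
have hE e i j : (h e i < h e j)%N = (key e i < key e j)%N.
  by rewrite /h; case: rank_perm.
rewrite [RHS](reindex_onto E h) => [|e Qe]; last first.
  by have [] := Qkey _ _ Qe (hE e).
apply: eq_bigl => s; apply/idP/andP => [Ps|[QE /eqP hs]].
  split; first exact: PQ.
  apply/eqP; apply: perm_order_inj => i j; rewrite hE; exact: Pkey.
by have [] := Qkey _ _ QE (hE (E s)); rewrite hs.
Qed.

Lemma ltn_adjacent (f : 'I_n -> nat) :
    (forall i j, j = i.+1 :> nat -> (f i < f j)%N) ->
  forall i j, (i < j)%N -> (f i < f j)%N.
Proof.
move=> fS i [j jn] /=; elim: j jn => // j IHj jn.
have jn' : (j < n)%N by apply: ltnW.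
have step : (f (Ordinal jn') < f (Ordinal jn))%N by apply: fS.
rewrite ltnS leq_eqVlt => /predU1P[ij|/(IHj jn')/ltn_trans]; last exact.
by have -> : i = Ordinal jn' by apply: val_inj.
Qed.

Lemma sorted_map_enum (f : 'I_n -> nat) :
    (forall i j, (i <= j)%N -> (f i <= f j)%N) ->
  sorted leq (map f (enum 'I_n)).
Proof.
move=> f_mono; rewrite sorted_map.
have : sorted leq (map val (enum 'I_n)) by rewrite val_enum_ord iota_sorted.
rewrite sorted_map; apply: sub_sorted => i j; exact: f_mono.
Qed.

(** Read along [s^-1], the word [w] is weakly increasing, so it is the sorted rearrangement of its
    content, which is [b]. *)
Lemma perm_sorts (w b : 'I_n -> nat) s :
    perm_eq (map w (enum 'I_n)) (map b (enum 'I_n)) ->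
    (forall i j, (i <= j)%N -> (b i <= b j)%N) ->
    (forall i j, (w i < w j)%N -> (s i < s j)%N) ->
  forall i, b (s i) = w i.
Proof.
move=> wb b_mono ws i.
have eqs : map (w \o s^-1)%g (enum 'I_n) = map b (enum 'I_n).
  apply: (sorted_eq leq_trans anti_leq).
  - apply: sorted_map_enum => j k jk /=; rewrite leqNgt; apply: contraL jk.
    by move/ws; rewrite !permKV -ltnNge.
  - exact: sorted_map_enum.
  apply: perm_trans wb; rewrite map_comp; apply: perm_map.
  apply: uniq_perm; rewrite ?enum_uniq //.
    by rewrite map_inj_uniq ?enum_uniq //; apply: perm_inj.
  move=> j; rewrite mem_enum; apply/mapP; exists (s j); rewrite ?mem_enum //.
  by rewrite permK.
by move/eq_in_map/(_ (s i)): eqs => <-; rewrite ?mem_enum //= permK.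
Qed.

Lemma prod_sum_bool (R : comNzRingType) (x : R) (ok : 'I_n -> bool -> bool) :
  \prod_i \sum_b (if ok i b then x ^+ b else 0) =
  \sum_(e : {ffun 'I_n -> bool} | [forall i, ok i (e i)]) x ^+ (\sum_i e i).
Proof.
rewrite bigA_distr_bigA [RHS]big_mkcond /=; apply: eq_bigr => e _.
case: ifPn => [/forallP oke|]; last first.
  by rewrite negb_forall => /existsP[i /negPf oki]; rewrite (bigD1 i) //= oki mul0r.
rewrite expr_sum; apply: eq_bigr => i _; by rewrite oke.
Qed.

End Ranks.

(** Numbers written in base [m] compare lexicographically; the sorting keys rest on this. *)
Lemma ltn_lex m a b i j : (i < m)%N -> (j < m)%N ->
  (a * m + i < b * m + j)%N = (a < b)%N || (a == b) && (i < j)%N.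
Proof.
move=> im jm; case: (ltngtP a b) => [ab|ba|->] /=; last by rewrite ltn_add2l.
  have : (a.+1 * m <= b * m)%N by rewrite leq_mul2r ab orbT.
  by rewrite mulSn; lia.
have : (b.+1 * m <= a * m)%N by rewrite leq_mul2r ba orbT.
by rewrite mulSn; lia.
Qed.

(** * Descent sets and words of blocks *)

Section DescentSets.

Variable n : nat.
Implicit Types (s : 'S_n) (i j k : 'I_n).

(* Descents of the word of s in which the letters s i with i < s i are barred,
   a barred letter being smaller than any unbarred one. *)
Definition bar_descent s i j : bool :=
  ~~ (i < s i)%N && (j < s j)%N
  || ((i < s i)%N == (j < s j)%N) && (s j < s i)%N.

Definition DEX s : {set 'I_n} :=
  [set i : 'I_n | [exists j : 'I_n, (j == i.+1 :> nat) && bar_descent s i j]].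

Definition Des2 s : {set 'I_n} :=
  [set i : 'I_n | [exists j : 'I_n, (j == i.+1 :> nat) && (s j + 2 <= s i)%N]].

(** With [i = s j], the bit at [j] says that [i] is an excedance of [s^-1], the permutation whose
    [DEX] is constrained. *)
Definition exc_word (s : 'S_n) : {ffun 'I_n -> bool} := [ffun j => (s j < j)%N].

Definition des_word (s : 'S_n) : {ffun 'I_n -> bool} := [ffun j => j \in Des s].

Lemma adjacent_subsetP (S : {set 'I_n}) (r : 'I_n -> 'I_n -> bool) :
  reflect (forall i j, j = i.+1 :> nat -> i \notin S -> ~~ r i j)
    ([set i : 'I_n | [exists j : 'I_n, (j == i.+1 :> nat) && r i j]] \subset S).
Proof.
apply: (iffP subsetP) => [sub i j ij|sub i].
  by apply: contra => rij; apply: sub; rewrite inE; apply/existsP; exists j;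
     rewrite ij eqxx.
rewrite inE => /existsP[j /andP[/eqP ij]]; apply: contraLR; exact: sub.
Qed.

Lemma Des_adjacent s (i j : 'I_n) : j = i.+1 :> nat -> (i \in Des s) = (s j < s i)%N.
Proof.
move=> ij; rewrite inE; apply/existsP/idP => [[k /andP[/eqP ik]]|lt].
  by have -> : j = k by apply: val_inj; rewrite /= ij ik.
by exists j; rewrite ij eqxx.
Qed.

Variable S : {set 'I_n}.

(** Positions are cut after each element of [S], so this count numbers the blocks from 0. *)
Definition block m : nat := #|[set j in S | (j < m)%N]|.

Definition block_word s : seq nat := [seq block (s j) | j <- enum 'I_n].

Lemma leq_block m1 m2 : (m1 <= m2)%N -> (block m1 <= block m2)%N.
Proof.
move=> le; apply: subset_leq_card; apply/subsetP => j; rewrite !inE.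
by case/andP=> -> /leq_trans; apply.
Qed.

Lemma ltn_block m1 m2 : (block m1 < block m2)%N -> (m1 < m2)%N.
Proof. by apply: contraLR; rewrite -!leqNgt; apply: leq_block. Qed.

Lemma blockS i j : j = i.+1 :> nat -> block j = ((i \in S) + block i)%N.
Proof.
move=> ij; rewrite /block ij; case: (boolP (i \in S)) => iS.
  have -> : [set k in S | (k < i.+1)%N] = i |: [set k in S | (k < i)%N].
    apply/setP => k; rewrite !inE ltnS leq_eqVlt andb_orr.
    congr (_ || _); apply/andP/idP => [[_ /eqP/val_inj->]//|/eqP->].
    by rewrite iS eqxx.
  by rewrite cardsU1 inE ltnn andbF.
apply: eq_card => k; rewrite !inE ltnS leq_eqVlt.
case: (eqVneq (k : nat) i) => [/val_inj->|//]; by rewrite (negPf iS).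
Qed.

Lemma map_block_enum : [seq block (i : 'I_n) | i <- enum 'I_n] = mkseq block n.
Proof. by rewrite /mkseq -val_enum_ord -map_comp. Qed.

Variable w : seq nat.
Hypothesis w_content : perm_eq w (mkseq block n).

Let size_w : size w = n.
Proof. by rewrite (perm_size w_content) size_mkseq. Qed.

Lemma map_nth_enum : [seq nth 0%N w (i : 'I_n) | i <- enum 'I_n] = w.
Proof.
rewrite (map_comp (nth 0%N w) (fun i : 'I_n => val i)) val_enum_ord.
by rewrite -[X in iota _ X]size_w; apply: mkseq_nth.
Qed.

Lemma block_wordP s :
  reflect (forall j, block (s j) = nth 0%N w j) (block_word s == w).
Proof.
rewrite -[X in _ == X]map_nth_enum; apply: (iffP eqP) => [/eq_in_map eqw j|eqw].
  by apply: eqw; rewrite mem_enum.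
by apply: eq_map => j; apply: eqw.
Qed.

Lemma block_perm_sorts s :
    (forall i j, (nth 0%N w i < nth 0%N w j)%N -> (s i < s j)%N) ->
  forall j, block (s j) = nth 0%N w j.
Proof.
apply: (@perm_sorts n (fun i => nth 0%N w i) (fun i => block i)).
  by rewrite map_nth_enum map_block_enum.
by move=> i j; apply: leq_block.
Qed.

(** * The excedance side of a fibre *)

Definition block_start m : bool := block m \notin mkseq block m.

Lemma block_startP i j : block_start j -> (i < j)%N -> (block i < block j)%N.
Proof.
move=> bj ij; rewrite ltn_neqAle leq_block ?(ltnW ij) // andbT.
apply: contra bj => /eqP <-; apply/mapP; exists (val i) => //.
by rewrite mem_iota.
Qed.

Lemma block_startPn j : ~~ block_start j ->
  exists k : 'I_n, [/\ (k < j)%N, block k = block j & block_start k].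
Proof.
rewrite negbK => /mapP[m0]; rewrite mem_iota /= add0n => m0j bm0.
have ex : exists m, block m == block j by exists m0; rewrite bm0.
case: (ex_minnP ex) => m /eqP bm mmin.
have mj : (m < j)%N by apply: leq_ltn_trans m0j; apply: mmin; rewrite bm0.
exists (Ordinal (ltn_trans mj (ltn_ord j))); split=> //=.
rewrite /block_start bm; apply/mapP => -[m1]; rewrite mem_iota /= add0n => m1m.
by move/eqP; rewrite eq_sym => /mmin; rewrite leqNgt m1m.
Qed.

(* e tells whether j is the image of an excedance; the smallest element of a
   block cannot be the image of an excedance inside that block. *)
Definition exc_ok j (e : bool) : bool :=
  if (nth 0%N w j < block j)%N then e
  else if (block j < nth 0%N w j)%N then ~~ e
  else ~~ (block_start j && e).

(** Inside a block, barred letters come first and each kind increases: the only arrangement without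
    a bar descent there. *)
Definition exc_key (e : {ffun 'I_n -> bool}) j : nat :=
  ((nth 0%N w j).*2 + ~~ e j) * n + j.

Lemma exc_keyE e i j : (exc_key e i < exc_key e j)%N =
  [|| (nth 0%N w i < nth 0%N w j)%N |
   (nth 0%N w i == nth 0%N w j) &&
     (e i && ~~ e j || (e i == e j) && (i < j)%N)].
Proof.
rewrite /exc_key ltn_lex //.
by case: (e i); case: (e j); case: (ltngtP (nth 0%N w i)) => /= *; lia.
Qed.

Lemma exc_key_inj e : injective (exc_key e).
Proof.
move=> i j /(congr1 (modn^~ n)); rewrite /exc_key !modnMDl !modn_small //.
exact: val_inj.
Qed.

Lemma exc_key_homo s : DEX s^-1 \subset S ->
    (forall j, block (s j) = nth 0%N w j) ->
  forall i j, (exc_key (exc_word s) i < exc_key (exc_word s) j)%N ->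
    (s i < s j)%N.
Proof.
move=> /adjacent_subsetP sub sw i j.
(* The keys of the letters of [s^-1] increase at each step: at a cut the block number grows,
   elsewhere there is no bar descent. *)
have step (p p' : 'I_n) : p' = p.+1 :> nat ->
  (exc_key (exc_word s) ((s^-1)%g p) < exc_key (exc_word s) ((s^-1)%g p'))%N.
  move=> pp'; rewrite exc_keyE -!sw !ffunE !permKV (blockS pp').
  have := sub _ _ pp'; case: (p \in S) => [_|/(_ isT)]; first by rewrite ltnSn.
  rewrite ltnn eqxx /bar_descent /= negb_or !negb_and.
  have : (s^-1)%g p != (s^-1)%g p' :> nat.
    by rewrite (inj_eq val_inj) (inj_eq perm_inj) -(inj_eq val_inj) /= pp'; lia.
  case: (p < _)%N; case: (p' < _)%N => //=; lia.
have mono := ltn_adjacent step.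
move=> lt; case: (ltngtP (s i) (s j)) => // [/mono|/val_inj/perm_inj eqij].
  by rewrite !permK => /(ltn_trans lt); rewrite ltnn.
by move: lt; rewrite eqij ltnn.
Qed.

Lemma exc_word_ok s : (forall j, block (s j) = nth 0%N w j) ->
  [forall j, exc_ok j (exc_word s j)].
Proof.
move=> sw; apply/forallP => j; rewrite /exc_ok -sw ffunE.
case: ltngtP => [/ltn_block//|/ltn_block|eqb]; first by rewrite -leqNgt => /ltnW.
apply/andP => -[st lt]; have := block_startP st lt.
by rewrite eqb ltnn.
Qed.

Section FromKey.

Variables (e : {ffun 'I_n -> bool}) (s : 'S_n).
Hypothesis e_ok : forall j, exc_ok j (e j).
Hypothesis s_key : forall i j, (s i < s j)%N = (exc_key e i < exc_key e j)%N.

Let sw j : block (s j) = nth 0%N w j.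
Proof.
by apply: block_perm_sorts => i k lt; rewrite s_key exc_keyE lt.
Qed.

(* Counting the letters that precede j: those of smaller blocks fill the
   smaller blocks, and the barred ones of the block of j lie strictly between
   its smallest element and j. *)
Lemma exc_key_lt j : nth 0%N w j = block j -> e j -> (s j < j)%N.
Proof.
move=> wj ej.
have := e_ok j; rewrite /exc_ok wj ltnn ej andbT => /block_startPn.
case=> k [kj bk kst].
rewrite -(card_perm_lt s) -[X in (_ < X)%N](@card_ord_ltn n) ?(ltnW (ltn_ord j)) //.
set A := [set i : 'I_n | (block i < block j)%N].
set B := [set i : 'I_n | (k < i < j)%N].
apply: (@leq_ltn_trans #|(s @^-1: A) :|: B|).
  apply: subset_leq_card; apply/subsetP => i; rewrite !inE s_key exc_keyE -!sw.
  rewrite (sw j) wj ej /= andbF /=; case/orP=> [->//|/andP[/eqP si /andP[/eqP ei ij]]].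
  apply/orP; right; rewrite ij andbT.
  have := e_ok i; rewrite /exc_ok ei -sw si andbT.
  have := leq_block (ltnW ij); rewrite leqNgt => /negPf ->.
  case: ltngtP (leq_block (ltnW ij)) => // bij _ nst.
  rewrite ltn_neqAle; apply/andP; split.
    by apply: contra nst => /eqP <-.
  rewrite leqNgt; apply/negP => ik; have := block_startP kst ik.
  by rewrite bk -bij ltnn.
apply: (@leq_ltn_trans (#|A| + #|B|)%N).
  rewrite -[#|A|](card_preimset _ (@perm_inj _ s)); exact: leq_card_setU.
have -> : (#|A| + #|B|)%N = #|A :|: B|.
  rewrite cardsU; suff -> : A :&: B = set0 by rewrite cards0 subn0.
  apply/setP => i; rewrite !inE; apply/negP => /andP[lt /andP[ki _]].
  by move: lt; rewrite -bk ltnNge leq_block // ltnW.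
(* The block start [k] lies below [j] but outside [A] and [B], which makes the bound strict. *)
apply: proper_card; apply/properP; split.
  by apply/subsetP => i; rewrite !inE => /orP[/ltn_block|/andP[]].
by exists k; rewrite !inE ?kj // bk !ltnn.
Qed.

(** The dual count, of the letters that follow [j]: those of later blocks fill the later blocks, and
    the unbarred ones of the block of [j] are elements of that block above [j]. *)
Lemma exc_key_ge j : nth 0%N w j = block j -> ~~ e j -> (j <= s j)%N.
Proof.
move=> wj ej.
suff : (#|[set i | (s j < s i)%N]| <= #|[set i : 'I_n | (j < i)%N]|)%N.
  have cg (f : 'S_n) i : #|[set k | (f i < f k)%N]| = (n - (f i).+1)%N.
    have := cardsC (f @^-1: [set k : 'I_n | (k < (f i).+1)%N]).
    rewrite card_preimset; last exact: perm_inj.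
    rewrite card_ord_ltn // card_ord => cC.
    rewrite -[RHS]/(subn n (f i).+1) -[X in (X - _)%N]cC addKn.
    by apply: eq_card => k; rewrite !inE -leqNgt.
  have := cg 1%g j; have := cg s j; rewrite perm1 => -> cj.
  have -> : [set i : 'I_n | (j < i)%N] = [set k | (j < (1%g : 'S_n) k)%N].
    by apply/setP => i; rewrite !inE perm1.
  by rewrite cj; have := ltn_ord j; have := ltn_ord (s j); lia.
set A := [set i : 'I_n | (block j < block i)%N].
set B := [set i : 'I_n | (j < i)%N && (block i == block j)].
apply: (@leq_trans #|(s @^-1: A) :|: B|).
  apply: subset_leq_card; apply/subsetP => i; rewrite !inE s_key exc_keyE -!sw.
  rewrite (sw j) wj (negPf ej) /=.
  case/orP=> [->//|/andP[/eqP si /andP[/eqP ei ij]]].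
  apply/orP; right; rewrite ij /= eqn_leq (leq_block (ltnW ij)) andbT.
  by have := e_ok i; rewrite /exc_ok -ei -sw -si; case: ltngtP.
apply: (@leq_trans (#|A| + #|B|)%N).
  rewrite -[#|A|](card_preimset _ (@perm_inj _ s)); exact: leq_card_setU.
have -> : (#|A| + #|B|)%N = #|A :|: B|.
  rewrite cardsU; suff -> : A :&: B = set0 by rewrite cards0 subn0.
  by apply/setP => i; rewrite !inE; case: ltngtP; rewrite ?andbF.
apply: subset_leq_card; apply/subsetP => i; rewrite !inE.
by case/orP=> [/ltn_block|/andP[]].
Qed.

Lemma exc_word_of_key : exc_word s = e.
Proof.
apply/ffunP => j; rewrite ffunE.
have := e_ok j; rewrite /exc_ok -sw.
case: ltngtP => [/ltn_block -> -> //|/ltn_block lt /negPf->|eqb _].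
  by apply/negbTE; rewrite -leqNgt ltnW.
case: (boolP (e j)) => ej; first by apply: exc_key_lt; rewrite // -sw.
by apply/negbTE; rewrite -leqNgt exc_key_ge // -sw.
Qed.

Lemma DEX_of_key : DEX s^-1 \subset S.
Proof.
apply/adjacent_subsetP => p p' pp' pS; apply/negP => bd.
have : (exc_key e ((s^-1)%g p) < exc_key e ((s^-1)%g p'))%N.
  by rewrite -s_key !permKV pp'.
rewrite exc_keyE -!sw !permKV (blockS pp') (negPf pS) ltnn eqxx /=.
rewrite -exc_word_of_key !ffunE !permKV; move: bd; rewrite /bar_descent.
by case: (p < _)%N; case: (p' < _)%N => //=; lia.
Qed.

End FromKey.

(** The bits of [exc_word] can be chosen independently subject to [exc_ok], so the sum factors over
    [j], each factor summing over the admissible bits. *)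
Lemma sum_exc_word (R : comNzRingType) (x : R) :
  \sum_(s : 'S_n | (DEX s^-1 \subset S) && (block_word s == w))
     x ^+ (\sum_j exc_word s j)
  = \prod_(j < n) exit_weight x (block j, block_start j) (nth 0%N w j).
Proof.
transitivity (\sum_(e : {ffun 'I_n -> bool} | [forall j, exc_ok j (e j)])
                 x ^+ (\sum_j e j)).
  apply: (@sum_perm_rank _ _ exc_key exc_word _ _
            (fun e : {ffun 'I_n -> bool} => x ^+ (\sum_j e j))).
  - exact: exc_key_inj.
  - by move=> s /andP[_ /block_wordP]; apply: exc_word_ok.
  - by move=> s /andP[sub /block_wordP]; apply: exc_key_homo.
  move=> e s /forallP e_ok s_key; split; last exact: exc_word_of_key.
  rewrite (DEX_of_key e_ok s_key); apply/block_wordP; apply: block_perm_sorts.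
  by move=> i j lt; rewrite s_key exc_keyE lt.
rewrite -prod_sum_bool; apply: eq_bigr => j _.
rewrite big_bool /exc_ok /exit_weight /step_weight /= expr0 expr1.
case: ltngtP => /=; rewrite ?add0r ?addr0 ?andbF // => _.
by case: block_start => /=; rewrite ?add0r // addrC.
Qed.

(** * The descent side of a fibre *)

Definition des_ok (k : 'I_n) (e : bool) : bool :=
  if (k.+1 < n)%N then
    if (nth 0%N w k < nth 0%N w k.+1)%N then ~~ e
    else if (nth 0%N w k.+1 < nth 0%N w k)%N then e else true
  else ~~ e.

(** Indexed by natural numbers so that [run_start] can recurse; false from [n] on. *)
Definition joined (e : {ffun 'I_n -> bool}) m : bool :=
  [exists i : 'I_n, (i == m :> nat) && e i]
  && (nth 0%N w m == nth 0%N w m.+1).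

Fixpoint run_start e m : nat :=
  if m is m'.+1 then if joined e m' then run_start e m' else m else 0%N.

(* Inside a block the maximal runs of joined letters appear from left to right,
   each of them in decreasing order. *)
Definition des_key (e : {ffun 'I_n -> bool}) (k : 'I_n) : nat :=
  (nth 0%N w k * n.+1 + run_start e k) * n.+1 + (n - k).

Lemma joinedE e (k : 'I_n) :
  joined e k = e k && (nth 0%N w k == nth 0%N w k.+1).
Proof.
congr (_ && _); apply/existsP/idP => [[i /andP[/eqP/val_inj->]] //|ek].
by exists k; rewrite eqxx.
Qed.

Lemma run_start_le e m : (run_start e m <= m)%N.
Proof. by elim: m => //= m IHm; case: ifP => // _; apply: leqW. Qed.

Lemma leq_run_start e m1 m2 :
  (m1 <= m2)%N -> (run_start e m1 <= run_start e m2)%N.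
Proof.
move/subnK<-; elim: (m2 - m1)%N => //= m IHm; apply: leq_trans IHm _.
by case: ifP => // _; apply: leqW; apply: run_start_le.
Qed.

Lemma run_start_joined e m1 m2 : (m1 <= m2)%N ->
    (forall m, (m1 <= m < m2)%N -> joined e m) ->
  run_start e m2 = run_start e m1.
Proof.
elim: m2 => [|m2 IHm2]; first by rewrite leqn0 => /eqP->.
rewrite leq_eqVlt => /predU1P[->//|]; rewrite ltnS => m12 jn /=.
rewrite jn ?m12 ?ltnSn // IHm2 // => m /andP[m1m mm2].
by apply: jn; rewrite m1m ltnW.
Qed.

Lemma joined_run e m1 m2 m : (run_start e m2 <= m1)%N ->
  (m1 <= m < m2)%N -> joined e m.
Proof.
elim: m2 => [|m2 IHm2] /=; first by rewrite ltn0 andbF.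
case: ifP => [jm2 rs|_ m2m1 /andP[m1m]]; last first.
  by rewrite ltnS leqNgt (leq_trans m2m1).
case/andP=> m1m; rewrite ltnS leq_eqVlt => /predU1P[->//|mm2].
by apply: IHm2; rewrite // m1m.
Qed.

Lemma des_keyE e (i j : 'I_n) : (des_key e i < des_key e j)%N =
  [|| (nth 0%N w i < nth 0%N w j)%N |
   (nth 0%N w i == nth 0%N w j) &&
     ((run_start e i < run_start e j)%N ||
      (run_start e i == run_start e j) && (j < i)%N)].
Proof.
have rs k : (run_start e (k : 'I_n) < n.+1)%N.
  by apply: leq_ltn_trans (run_start_le _ _) _; apply: leqW.
rewrite /des_key !ltn_lex ?rs ?ltnS ?leq_subr //.
have -> : (n - i < n - j)%N = (j < i)%N.
  by have := ltn_ord i; have := ltn_ord j; lia.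
case: (eqVneq (nth 0%N w i) (nth 0%N w j)) => [->|ne] /=.
  by rewrite ltnn eqn_add2l.
suff -> : ((nth 0%N w i * n.+1 + run_start e i)%N
            == (nth 0%N w j * n.+1 + run_start e j)%N) = false by rewrite !orbF.
apply: contraNF ne => /eqP/(congr1 (divn^~ n.+1)).
by rewrite !divnMDl // !divn_small // !addn0 => ->.
Qed.

Lemma des_key_inj e : injective (des_key e).
Proof.
move=> i j /(congr1 (modn^~ n.+1)); rewrite /des_key !modnMDl.
rewrite !modn_small ?ltnS ?leq_subr // => eqs; apply: val_inj => /=.
by have := ltn_ord i; have := ltn_ord j; lia.
Qed.

Lemma joined_descents s (i j : 'I_n) : (i < j)%N ->
    (forall m, (i <= m < j)%N -> joined (des_word s) m) ->
  (s j < s i)%N.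
Proof.
case: j => j jn /=; elim: j jn => // j IHj jn; rewrite ltnS => ij jnd.
pose j0 := Ordinal (ltnW jn).
have : joined (des_word s) j0 by apply: jnd; rewrite ij /=.
rewrite joinedE ffunE (@Des_adjacent _ j0 (Ordinal jn)) // => /andP[lt _].
move: ij; rewrite leq_eqVlt => /predU1P[eij|ij].
  by have -> : i = j0 by apply: val_inj.
apply: ltn_trans lt (IHj _ ij _) => m /andP[im mj].
by apply: jnd; rewrite im ltnW.
Qed.

(* Going from left to right within a block, the values decrease by at most one
   at each step, hence every intermediate value is met. *)
Lemma joined_between s (i j : 'I_n) : Des2 s^-1 \subset S ->
    (forall k, block (s k) = nth 0%N w k) ->
    (i < j)%N -> (s j < s i)%N -> nth 0%N w i = nth 0%N w j ->
  forall m, (i <= m < j)%N -> joined (des_word s) m.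
Proof.
move=> /adjacent_subsetP sub sw; case: j => j jn.
elim: j jn => // j IHj jn; set J := Ordinal jn => ij sji wij m /andP[im mj].
pose P (p : 'I_n) := (s J < p)%N && ((s^-1)%g p < J)%N.
have Psi : P (s i) by rewrite /P sji permK.
(* [p] is the first position after that of [J] whose letter is below [J]. The letter just before it
   is at least [J], so a drop of at most one forces the letter at [p] to be [J - 1]. *)
case: (@arg_minnP _ (s i) P val Psi) => p /andP[Jp pJ] pmin.
have psi : (p <= s i)%N := pmin _ Psi.
have p0 : (0 < p)%N by apply: leq_ltn_trans Jp.
have qn : (p.-1 < n)%N by rewrite prednK // ltnW.
pose q := Ordinal qn; have pq : p = q.+1 :> nat by rewrite /= prednK.
have Jq : (s J <= q)%N by rewrite -ltnS -pq.
have qJ : (J <= (s^-1)%g q)%N.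
  case: (eqVneq (s J) q) => [<-|ne]; first by rewrite permK.
  rewrite leqNgt; apply/negP => lt; have := pmin q; rewrite /P lt andbT.
  rewrite ltn_neqAle Jq andbT => /(_ ne) pleq.
  by have : (p <= q)%N by []; rewrite pq ltnn.
have bJi : block (s J) = block (s i) by rewrite !sw -wij.
have b1 := leq_block Jq; have b2 := leq_block psi.
have bqp := blockS pq.
have qS : q \notin S by apply/negP => qS; move: bqp; rewrite qS; lia.
have bp : block p = block (s J) by rewrite bqp (negPf qS); lia.
have step := sub _ _ pq qS.
have jn' : (j < n)%N := ltnW jn; pose J' := Ordinal jn'.
have pE : (s^-1)%g p = J'.
  by apply: val_inj => /=; move: pJ qJ step; rewrite /J /=; lia.
have {pE} pE : p = s J' by rewrite -pE permKV.
have jJ : joined (des_word s) J'.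
  rewrite joinedE ffunE (@Des_adjacent _ J' J) // -pE Jp /=.
  by have := sw J'; have := sw J; rewrite /= -pE bp => -> ->.
move: mj; rewrite /= ltnS leq_eqVlt => /predU1P[->//|mj].
have ij' : (i < j)%N by apply: leq_ltn_trans mj.
apply: (IHj jn') => //; last by rewrite im.
  rewrite -/J' -pE ltn_neqAle psi andbT.
  apply/negP => /eqP/val_inj; rewrite pE => /perm_inj eji.
  by move: ij'; rewrite -eji /= ltnn.
by rewrite wij -!sw -/J' -pE bp.
Qed.

Lemma des_key_homo s : Des2 s^-1 \subset S ->
    (forall k, block (s k) = nth 0%N w k) ->
  forall i j, (des_key (des_word s) i < des_key (des_word s) j)%N ->
    (s i < s j)%N.
Proof.
move=> sub sw i j lt; case: (ltngtP (s i) (s j)) => // [sji|]; last first.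
  by move/val_inj/perm_inj=> eij; move: lt; rewrite eij ltnn.
suff : (des_key (des_word s) j < des_key (des_word s) i)%N.
  by move/(ltn_trans lt); rewrite ltnn.
rewrite des_keyE -!sw; case: ltngtP (leq_block (ltnW sji)) => //= bji _.
(* If [i < j], both lie in one run, which the key reverses; if [j < i], they lie in different runs,
   since [s] decreases along a run. *)
case: (ltngtP i j) => [ij|ji|/val_inj eij]; last 1 first.
- by move: sji; rewrite eij ltnn.
- rewrite andbT orbC (run_start_joined (ltnW ij)) ?eqxx //.
  by apply: joined_between; rewrite // -!sw.
rewrite andbF orbF ltn_neqAle leq_run_start ?(ltnW ji) // andbT.
apply/eqP => eqr; have : (s i < s j)%N.
  apply: joined_descents => // m; apply: joined_run.
  by rewrite -eqr run_start_le.
by move/(ltn_trans sji); rewrite ltnn.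
Qed.

Lemma des_word_ok s : (forall j, block (s j) = nth 0%N w j) ->
  [forall j, des_ok j (des_word s j)].
Proof.
move=> sw; apply/forallP => k; rewrite /des_ok ffunE; case: ifPn => [kn|kn].
  have := sw (Ordinal kn); rewrite (@Des_adjacent _ k (Ordinal kn)) //= => <-.
  rewrite -sw; case: ltngtP => // /ltn_block //.
  by rewrite -leqNgt => /ltnW.
rewrite inE; apply: contra kn => /existsP[j /andP[/eqP <- _]].
exact: ltn_ord.
Qed.

Section FromDesKey.

Variables (e : {ffun 'I_n -> bool}) (s : 'S_n).
Hypothesis e_ok : forall j, des_ok j (e j).
Hypothesis s_key : forall i j, (s i < s j)%N = (des_key e i < des_key e j)%N.

Let sw j : block (s j) = nth 0%N w j.
Proof.
by apply: block_perm_sorts => i k lt; rewrite s_key des_keyE lt.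
Qed.

Lemma des_word_of_key : des_word s = e.
Proof.
apply/ffunP => k; rewrite ffunE; have := e_ok k; rewrite /des_ok.
case: ifPn => kn; last first.
  move/negPf->; apply: contraNF kn; rewrite inE => /existsP[j /andP[/eqP <- _]].
  exact: ltn_ord.
rewrite (@Des_adjacent _ k (Ordinal kn)) // s_key des_keyE /= joinedE ltnS leqnn.
case: (ltngtP (nth 0%N w k) (nth 0%N w k.+1)) => /= [_ /negPf->|_ ->|_ _] //.
rewrite ?andbT.
(* If [e k] holds, [k] and [k.+1] share a run, which the key reverses; otherwise [k.+1] opens a
   later run. *)
case: (e k) => /=; first by rewrite eqxx orbT.
by have := run_start_le e k; case: ltngtP => //; lia.
Qed.

(** If letters [k] and [k'] with [k' + 2 <= k] were adjacent in a block, they would share a run, and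
    the key would place [k'.+1] strictly between them. *)
Lemma Des2_of_key : Des2 s^-1 \subset S.
Proof.
apply/adjacent_subsetP => p p' pp' pS; apply/negP => d2.
pose k := (s^-1)%g p; pose k' := (s^-1)%g p'.
have kp : s k = p by rewrite permKV.
have kp' : s k' = p' by rewrite permKV.
have wkk : nth 0%N w k = nth 0%N w k'.
  by rewrite -!sw kp kp' (blockS pp') (negPf pS).
have k'k : (k' + 2 <= k)%N by [].
have mn : (k'.+1 < n)%N.
  by apply: leq_ltn_trans (ltn_ord k); move: k'k; lia.
pose m := Ordinal mn.
have : (des_key e k < des_key e k')%N by rewrite -s_key kp kp' pp'.
have r1 : (run_start e k' <= run_start e m)%N by apply: leq_run_start.
have r2 : (run_start e m <= run_start e k)%N.
  by apply: leq_run_start; rewrite /=; lia.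
rewrite des_keyE wkk ltnn eqxx /= => rk.
have rkk : run_start e k = run_start e k' by move: rk r1 r2; lia.
have rm : run_start e m = run_start e k' by move: rkk r1 r2; lia.
have : joined e k'.
  by apply: (@joined_run e k' m); rewrite ?rm ?run_start_le //= leqnn ltnSn.
rewrite joinedE => /andP[_ /eqP wm].
have {}wm : nth 0%N w m = nth 0%N w k' by rewrite wm.
have km : (s k < s m)%N.
  rewrite s_key des_keyE wkk wm rkk rm !ltnn !eqxx /=.
  by move: k'k; lia.
have mk' : (s m < s k')%N by rewrite s_key des_keyE wm rm !ltnn !eqxx /=.
by move: km mk'; rewrite kp kp' pp'; lia.
Qed.

End FromDesKey.

Lemma sum_des_word (R : comNzRingType) (x : R) :
  \sum_(s : 'S_n | (Des2 s^-1 \subset S) && (block_word s == w))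
     x ^+ (\sum_j des_word s j)
  = word_weight x w.
Proof.
transitivity (\sum_(e : {ffun 'I_n -> bool} | [forall j, des_ok j (e j)])
                 x ^+ (\sum_j e j)).
  apply: (@sum_perm_rank _ _ des_key des_word _ _
            (fun e : {ffun 'I_n -> bool} => x ^+ (\sum_j e j))).
  - exact: des_key_inj.
  - by move=> s /andP[_ /block_wordP]; apply: des_word_ok.
  - by move=> s /andP[sub /block_wordP]; apply: des_key_homo.
  move=> e s /forallP e_ok s_key; split; last exact: des_word_of_key.
  rewrite (Des2_of_key s_key); apply/block_wordP; apply: block_perm_sorts.
  by move=> i j lt; rewrite s_key des_keyE lt.
rewrite -prod_sum_bool word_weightE size_w; apply: eq_bigr => j _.
rewrite big_bool /des_ok /step_weight /= expr0 expr1.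
case: (j.+1 < n)%N => /=; last by rewrite add0r.
by case: ltngtP => _ /=; rewrite ?add0r ?addr0 // addrC.
Qed.

End DescentSets.

(** * Fibres, statistics and summation by parts *)

Lemma sum_fibers (R : nmodType) (I : finType) (T : eqType) (r : seq T)
    (P : pred I) (f : I -> T) (F : I -> R) :
    uniq r -> (forall i, P i -> f i \in r) ->
  \sum_(i | P i) F i = \sum_(w <- r) \sum_(i | P i && (f i == w)) F i.
Proof.
move=> r_uniq fr; rewrite (exchange_big_dep P) /=; last by move=> w i _ /andP[].
apply: eq_bigr => i Pi; rewrite -big_filter.
rewrite (eq_filter (a2 := pred1 (f i))); last first.
  by move=> w; rewrite /= Pi eq_sym.
by rewrite filter_pred1_uniq ?fr // big_seq1.
Qed.

(** The left side marks first occurrences, as block starts do, and [exits] marks last ones; either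
    way one copy of each letter is marked. *)
Lemma perm_exits_mkseq (f : nat -> nat) n :
  perm_eq (mkseq (fun i => (f i, f i \notin mkseq f i)) n) (exits (mkseq f n)).
Proof.
elim: n => // n IHn; rewrite mkseqS perm_rcons [X in exits X]mkseqS.
apply: (@perm_trans _ (exits (f n :: mkseq f n))); first by rewrite perm_cons.
by apply: perm_exits; rewrite perm_sym perm_rcons.
Qed.

Section Statistics.

Variable n : nat.
Implicit Types s : 'S_n.

Lemma exc_sum s : exc s = (\sum_j exc_word s^-1 j)%N.
Proof.
rewrite /exc -(card_preimset _ (@perm_inj _ s^-1)) -sum1_card big_mkcond /=.
apply: eq_bigr => j _; rewrite !inE ffunE permKV.
case: (ltnP ((s^-1)%g j) j) => [lt|_]; rewrite ?andbF ?andbT //.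
by rewrite (leq_ltn_trans lt).
Qed.

Lemma des_sum s : des s = (\sum_j des_word s j)%N.
Proof.
rewrite /des -sum1_card big_mkcond; apply: eq_bigr => j _; rewrite ffunE.
by case: (j \in _).
Qed.

(** A value [k.+1] standing to the left of [k] is a descent of [s^-1] at [k]. *)
Lemma inv_lt2_des s : inv_lt2 s = des s^-1.
Proof.
rewrite /inv_lt2 /des; set A := [set p | _].
have <- : [set s p.2 | p in A] = Des s^-1.
  apply/setP => k; apply/imsetP/idP => [[[i j]]|].
    rewrite inE /= => /andP[ij /eqP sij] ->.
    by rewrite (@Des_adjacent _ _ _ (s i)) // !permK.
  rewrite inE => /existsP[j /andP[/eqP jk lt]].
  exists ((s^-1)%g j, (s^-1)%g k); last by rewrite permKV.
  by rewrite inE /= lt !permKV jk eqxx.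
rewrite card_in_imset // => -[i j] [i' j']; rewrite !inE /=.
move=> /andP[_ /eqP sij] /andP[_ /eqP sij'] /perm_inj ejj; subst j'.
by congr (_, _); apply/(@perm_inj _ s)/val_inj; rewrite /= sij sij'.
Qed.

Lemma maj_ge2_sum s : maj_ge2 s = (\sum_(i in Des2 s) i.+1)%N.
Proof. by apply: eq_bigl => i; rewrite inE. Qed.

End Statistics.

Lemma sum_adjacent n (r : 'I_n.+1 -> 'I_n.+1 -> bool) :
  (\sum_(i in [set i : 'I_n.+1 |
       [exists j : 'I_n.+1, (j == i.+1 :> nat) && r i j]]) i.+1 =
   \sum_(i < n) r (inord i) (inord i.+1) * i.+1)%N.
Proof.
rewrite big_mkcond big_ord_recr /= [X in (_ + X)%N](_ : _ = 0%N) ?addn0; last first.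
  rewrite inE; case: existsP => // -[j /andP[/eqP /= jn _]].
  by have := ltn_ord j; rewrite jn ltnn.
apply: eq_bigr => i _; rewrite inE.
have ei : widen_ord (leqnSn n) i = inord i.
  by apply: val_inj; rewrite /= inordK // ltnW // ltnS.
have vi : (inord i : 'I_n.+1) = i :> nat by rewrite inordK // ltnW // ltnS.
have vi1 : (inord i.+1 : 'I_n.+1) = i.+1 :> nat by rewrite inordK // ltnS.
rewrite ei; have -> : [exists j : 'I_n.+1,
    (j == (inord i : 'I_n.+1).+1 :> nat) && r (inord i) j]
    = r (inord i) (inord i.+1).
  apply/existsP/idP => [[j /andP[/eqP ji]]|rij]; last first.
    by exists (inord i.+1); rewrite vi vi1 eqxx.
  by have -> : inord i.+1 = j by apply: val_inj; rewrite /= vi1 ji vi.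
by case: (r _ _); rewrite ?mul1n ?vi.
Qed.

Lemma sum_by_parts (f : nat -> nat) n :
  (\sum_(i < n) f i * i.+1 + n * f n =
   \sum_(i < n) f i.+1 * i.+1 + \sum_(i < n) f i)%N.
Proof.
elim: n => [|n IHn]; first by rewrite !big_ord0.
rewrite !big_ord_recr /=.
by rewrite [RHS]addnACA -{}IHn; move: (bigop _ _ _) => A; nia.
Qed.

(** With [e] the excedance indicator, the descent indicator at [i] exceeds the barred one by
    [e i - e i.+1]; weighted by [i.+1], these differences sum by parts to [exc s]. *)
Lemma maj_DEX n (s : 'S_n) : maj s = (exc s + \sum_(i in DEX s) i.+1)%N.
Proof.
case: n s => [|n] s.
  by rewrite /maj /exc !big_pred0 ?eq_card0 // => -[].
rewrite /maj /Des /DEX !sum_adjacent.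
pose e i : nat := ((inord i : 'I_n.+1) < s (inord i))%N.
(* When only one of the two letters is barred, their order is forced: a bar at [i] gives a descent,
   a bar at [i.+1] an ascent. *)
have step (i : 'I_n) :
    ((s (inord i.+1) < s (inord i))%N + e i.+1 =
     bar_descent s (inord i) (inord i.+1) + e i)%N.
  have vi : (inord i : 'I_n.+1) = i :> nat by rewrite inordK // ltnW // ltnS.
  have vi1 : (inord i.+1 : 'I_n.+1) = i.+1 :> nat by rewrite inordK // ltnS.
  have ne : s (inord i) != s (inord i.+1) :> nat.
    rewrite (inj_eq val_inj) (inj_eq perm_inj) -(inj_eq val_inj) /= vi vi1.
    by rewrite neq_ltn ltnSn.
  move: ne; rewrite /e /bar_descent vi vi1.
  case: (ltnP i (s (inord i))) => ha; case: (ltnP i.+1 (s (inord i.+1))) => hb;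
    case: ltngtP => //=; lia.
have en : e n = 0%N.
  by rewrite /e inordK // ltnNge -ltnS ltn_ord.
have -> : exc s = (\sum_(i < n) e i)%N.
  transitivity (\sum_(i < n.+1) e i)%N; last by rewrite big_ord_recr /= en addn0.
  rewrite /exc -sum1_card big_mkcond; apply: eq_bigr => i _.
  rewrite inE /e inord_val; case: (ltnP i (s i)) => [lt|_]; rewrite ?andbF ?andbT //.
  by rewrite (leq_ltn_trans lt).
have := sum_by_parts e n; rewrite en muln0 addn0 => parts.
have : (\sum_(i < n) ((s (inord i.+1) < s (inord i))%N + e i.+1) * i.+1 =
        \sum_(i < n) (bar_descent s (inord i) (inord i.+1) + e i) * i.+1)%N.
  by apply: eq_bigr => i _; rewrite step.
under eq_bigr do rewrite mulnDl.
under [in RHS]eq_bigr do rewrite mulnDl.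
rewrite !big_split /= parts => eqS; apply/eqP.
rewrite -(eqn_add2r (\sum_(i < n) e i.+1 * i.+1)%N) eqS addnC [eqbRHS]addnC.
by rewrite addnA.
Qed.

(* Moebius inversion: the product of y over a set T is the sum, over all S
   containing T, of a weight that depends on S only. *)
Lemma sum_expr_set (R : comNzRingType) (I J : finType) (f : I -> R)
    (A : I -> {set J}) (y : J -> R) :
  \sum_i (\prod_(k in A i) y k) * f i =
  \sum_(S : {set J}) (\prod_k (if k \in S then y k else 1 - y k)) *
     \sum_(i | A i \subset S) f i.
Proof.
pose mu (S : {set J}) := \prod_k (if k \in S then y k else 1 - y k).
transitivity (\sum_(S : {set J}) \sum_(i | A i \subset S) mu S * f i); last first.
  by apply: eq_bigr => S _; rewrite mulr_sumr.
rewrite (exchange_big_dep xpredT) //=; apply: eq_bigr => i _.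
rewrite -mulr_suml; congr (_ * _).
(* The product of [y k + g k] expands over subsets, and only those containing [A i] survive because
   [g] vanishes on [A i]. *)
pose g k := if k \in A i then 0 else 1 - y k.
transitivity (\prod_k (y k + g k)).
  rewrite big_mkcond; apply: eq_bigr => k _.
  by rewrite /g; case: ifP; rewrite ?addr0 // addrC subrK.
rewrite bigA_distr [RHS]big_mkcond; apply: eq_bigr => S _.
case: ifPn => [/subsetP sub|/subsetPn[k kA kS]]; last first.
  by rewrite (bigD1 k) //= (negPf kS) /g kA mul0r.
apply: eq_bigr => k _; case: ifPn => // kS; rewrite /g ifN //.
by apply: contra kS; apply: sub.
Qed.

(** * Equidistribution *)

Section Equidistribution.

Variables (R : comNzRingType) (n : nat).

Lemma sum_DEX_Des2 (x : R) (S : {set 'I_n}) :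
  \sum_(s : 'S_n | DEX s \subset S) x ^+ exc s =
  \sum_(s : 'S_n | Des2 s \subset S) x ^+ des s^-1.
Proof.
(* After inversion [s] sends each value to its position, so both sums split according to
   [block_word]. *)
rewrite (reindex_inj invg_inj) [RHS](reindex_inj invg_inj) /=.
pose bs := mkseq (block S) n.
have wordP s : block_word S s \in permutations bs.
  rewrite mem_permutations /bs -map_block_enum /block_word.
  rewrite (map_comp (fun i : 'I_n => block S i) s); apply: perm_map.
  apply: uniq_perm; rewrite ?enum_uniq //.
    by rewrite map_inj_uniq ?enum_uniq //; apply: perm_inj.
  move=> j; rewrite mem_enum; apply/mapP; exists ((s^-1)%g j).
    by rewrite mem_enum.
  by rewrite permKV.
rewrite (sum_fibers _ (permutations_uniq bs) (fun s _ => wordP s)).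
rewrite [RHS](sum_fibers _ (permutations_uniq bs) (fun s _ => wordP s)).
transitivity (exit_sum x (mkseq (fun i => (block S i, block_start S i)) n) bs).
  apply: eq_big_seq => w; rewrite mem_permutations => pw.
  have sw : size w = n by rewrite (perm_size pw) size_mkseq.
  rewrite (eq_bigr (fun s => x ^+ (\sum_j exc_word s j))); last first.
    by move=> s _; rewrite exc_sum invgK.
  rewrite sum_exc_word // (big_nth ((0%N, false), 0%N)) size1_zip size_mkseq ?sw //.
  rewrite big_mkord; apply: eq_bigr => j _.
  by rewrite nth_zip ?size_mkseq ?sw // nth_mkseq.
transitivity (exit_sum x (exits bs) bs).
  by apply: perm_exit_suml; [rewrite !size_mkseq | apply: perm_exits_mkseq].
rewrite exit_sum_exits; apply: eq_big_seq => w; rewrite mem_permutations => pw.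
rewrite -(sum_des_word pw); apply: eq_bigr => s _.
by rewrite invgK des_sum.
Qed.

Lemma sum_rmaj2_des (q t : R) :
  \sum_(s : 'S_n) q ^+ rmaj2 s * t ^+ des s^-1 =
  \sum_(s : 'S_n) q ^+ maj s * t ^+ exc s.
Proof.
(* The [q] carried by [f] merges with [t] into [x = q t]; each element [i] of [A s] keeps the weight
   [q ^+ i.+1], the [y] of [sum_expr_set]. *)
have E (A : 'S_n -> {set 'I_n}) (f : 'S_n -> nat) :
  \sum_s q ^+ (f s + \sum_(i in A s) i.+1) * t ^+ f s =
  \sum_s (\prod_(i in A s) q ^+ i.+1) * (q * t) ^+ f s.
  by apply: eq_bigr => s _; rewrite exprD expr_sum exprMn; ring.
under eq_bigr do rewrite /rmaj2 inv_lt2_des maj_ge2_sum.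
under [RHS]eq_bigr do rewrite maj_DEX.
rewrite (E _ (fun s => des s^-1)) (E _ (@exc n)) !sum_expr_set.
by apply: eq_bigr => S _; rewrite sum_DEX_Des2.
Qed.

End Equidistribution.

Theorem theorem4p16 (n : nat) (hn : (1 <= n)%N) :
  \sum_(s : 'S_n) q_var ^+ rmaj2 s * t_var ^+ des (s^-1)%g
  = \sum_(s : 'S_n) q_var ^+ maj s * t_var ^+ exc s.
Proof. exact: sum_rmaj2_des. Qed.
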